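(* Let $p\ge 1$ be fixed. Let $\{\varphi(\cdot\,|\,\gamma)\}_{\gamma\in\Gamma}$ be a regular infinite-dimensional exponential family (as defined in the context, with data $\lambda,\mathbb B,\mathbb B^*,\Gamma,\beta$). Let $\Theta$ be an open, connected subset of a separable Hilbert space $\mathbb H$, with norm $\|\cdot\|_\Theta=\|\cdot\|$ inherited from $\mathbb H$, let $\pi$ be a prior on $\Theta$, and let $g:\Theta\to\Gamma$ be a measurable mapping such that the statistical model is $\mu(\mathrm dx\,|\,\theta)=\varphi(x\,|\,g(\theta))\,\lambda(\mathrm dx)$. For a fixed $\theta_0\in\Theta$, suppose that: i) $\int_{\mathbb X}\|\beta_x\|_{\mathbb B}\,\varphi(x\,|\,g(\theta_0))\,\lambda(\mathrm dx)<+\infty$; ii) $\int_\Theta \exp\{n\,{}_{\mathbb B^*}\langle g(\tau),b\rangle_{\mathbb B}\}\,\pi(\mathrm d\tau)<+\infty$ for any $n\in\mathbb N$ and $b\in\mathbb B$; iii) $\int_\Theta\|\theta\|^{ap}\,\pi(\mathrm d\theta)<+\infty$ for some $a>1$; iv) there exist a sequence $\{\delta_n\}_{n\ge1}$ of positive numbers and positive constants $L_0^{(n)}$ such that, for every $n\in\mathbb N$, $$\mathcal W_p^{(\mathcal P(\Theta))}\big(\pi_n^*(\cdot\,|\,S_0);\pi_n^*(\cdot\,|\,S')\big)\le L_0^{(n)}\,\|S_0-S'\|_{\mathbb B}\qquad\text{for all } S'\in\mathcal U_{\delta_n}(S_0),$$ where $\mathcal U_{\delta_n}(S_0):=\{S\in\mathbb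 B:\|S_0-S\|_{\mathbb B}<\delta_n\}$. Then the PCR at $\theta_0$ given by $\epsilon_n=\mathbb E\big[\mathcal W_p^{(\mathcal P(\Theta))}(\pi_n(\cdot\,|\,\xi_1,\dots,\xi_n);\delta_{\theta_0})\big]$ satisfies $$\begin{aligned}\epsilon_n\lesssim{}&\Big(\int_\Theta\|\theta-\theta_0\|_\Theta^p\,\pi_n^*(\mathrm d\theta\,|\,S_0)\Big)^{1/p}+\|\theta_0\|_\Theta\,\mathbb P\big[\hat S_n\notin\mathcal U_{\delta_n}(S_0)\big]\\&+\Big(\mathbb E\Big[\int_\Theta\|\theta\|_\Theta^{ap}\,\pi_n^*(\mathrm d\theta\,|\,\hat S_n)\Big]\Big)^{\frac1{ap}}\Big(\mathbb P\big[\hat S_n\notin\mathcal U_{\delta_n}(S_0)\big]\Big)^{1-\frac1{ap}}+L_0^{(n)}\,\mathbb E\big[\|\hat S_n-S_0\|_{\mathbb B}\big].\end{aligned}$$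
   Context: Regular infinite-dimensional exponential family: $\mathbb X$ is a separable topological space with Borel $\sigma$-algebra $\mathscr X$; $\lambda$ is a $\sigma$-finite measure on $(\mathbb X,\mathscr X)$; $\mathbb B$ is a separable Banach space with dual $\mathbb B^*$ and pairing ${}_{\mathbb B^*}\langle\cdot,\cdot\rangle_{\mathbb B}$; $\Gamma$ is a nonempty open subset of $\mathbb B^*$; $\beta:\mathbb X\to\mathbb B$, $x\mapsto\beta_x$, is measurable; the interior of the convex hull of the support of $\lambda\circ\beta^{-1}$ is nonempty; and $\int_{\mathbb X}\exp\{{}_{\mathbb B^*}\langle\gamma,\beta_x\rangle_{\mathbb B}\}\lambda(\mathrm dx)<+\infty$ for all $\gamma\in\Gamma$. The family is given by the $\lambda$-densities $\varphi(x\,|\,\gamma)=\exp\{{}_{\mathbb B^*}\langle\gamma,\beta_x\rangle_{\mathbb B}-M_\varphi(\gamma)\}$, $\gamma\in\Gamma$, with $M_\varphi(\gamma)=\log\int_{\mathbb X}\exp\{{}_{\mathbb B^*}\langle\gamma,\beta_x\rangle_{\mathbb B}\}\lambda(\mathrm dx)$. Put $M(\theta)=M_\varphi(g(\theta))$. Let $\xi_1,\xi_2,\dots$ be i.i.d. $\mathbb X$-valued random variables on a probability space with probability $\mathbb P$ and expectation $\mathbb E$, with law $\mu_0=\mu(\cdot\,|\,\theta_0)$. Define $\hat S_n=\frac1n\sum_{i=1}^n\beta_{\xi_i}$, $S_0=\int_{\mathbb X}\beta_x\,\mu_0(\mathrm dx)$ (Bochner integral), and, for $b\in\mathbb B$,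 $$\pi_n^*(\mathrm d\theta\,|\,b)=\frac{\exp\{n[{}_{\mathbb B^*}\langle g(\theta),b\rangle_{\mathbb B}-M(\theta)]\}\,\pi(\mathrm d\theta)}{\int_\Theta\exp\{n[{}_{\mathbb B^*}\langle g(\tau),b\rangle_{\mathbb B}-M(\tau)]\}\,\pi(\mathrm d\tau)}.$$ The posterior distribution is $\pi_n(\cdot\,|\,x_1,\dots,x_n)=\pi_n^*(\cdot\,|\,\frac1n\sum_{i=1}^n\beta_{x_i})$. The $p$-Wasserstein distance on a separable metric space $(\mathbb M,d)$ is $\mathcal W_p^{(\mathcal P(\mathbb M))}(\gamma_1;\gamma_2)=\inf_\eta(\int_{\mathbb M^2}d(x,y)^p\,\eta(\mathrm dx\,\mathrm dy))^{1/p}$, the infimum over couplings $\eta$ of $\gamma_1,\gamma_2$. On $\Theta$ the distance is $\|\theta-\theta'\|_\Theta$. A sequence $\{\epsilon_n\}$ of positive numbers is a posterior contraction rate (PCR) at $\theta_0$ if $\pi_n(\{\theta:\|\theta-\theta_0\|_\Theta\ge M_n\epsilon_n\}\,|\,\xi_1,\dots,\xi_n)\to0$ in probability for every sequence of positive numbers $M_n\to\infty$. The notation $\lesssim$ means inequality up to a multiplicative constant not depending on $n$. *)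

(* Defs.v *)
From HB Require Import structures.
From mathcomp Require Import all_boot all_order all_algebra sesquilinear.
From mathcomp Require Import all_classical all_reals all_analysis.

Set Implicit Arguments.
Unset Strict Implicit.
Unset Printing Implicit Defensive.

Import Order.TTheory GRing.Theory Num.Theory.
Import numFieldNormedType.Exports.

Local Open Scope classical_set_scope.
Local Open Scope ring_scope.

(** * Topology and functional analysis *)

Definition separable (T : topologicalType) : Prop :=
  exists2 D : set T, countable D & dense D.

Notation borel T := (g_sigma_algebraType (@open T)).

(* A real Hilbert space is a Banach space whose norm comes from an inner
   product. *)
Definition hilbert (R : realType) (H : completeNormedModType R) : Prop :=
  exists ip : {dot H for @idfun R}, forall x : H, ip x x = `|x| ^+ 2.

Definition convex_hull (R : realType) (V : normedModType R) (A : set V) :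
    set V :=
  \bigcap_(C in [set C : set V | convex_set C /\ A `<=` C]) C.

Definition measure_support (R : realType) (T : ptopologicalType)
    (m : set (borel T) -> \bar R) : set T :=
  [set x | forall U : set T, open U -> U x -> (0 < m U)%E].

(** The topological dual, with the operator norm *)

Section dual.
Context {R : realType} (B : normedModType R).

Definition dual_pred : {pred (B -> R^o)} :=
  [pred f : B -> R^o | `[< linear f /\ continuous f >]].

Record dual := Dual { dual_fun :> B -> R^o ; _ : dual_fun \in dual_pred }.

HB.instance Definition _ := [isSub for dual_fun].
HB.instance Definition _ := [Choice of dual by <:].

Lemma dual_submod_closed : submod_closed dual_pred.
Proof.
split=> [|k f h /asboolP[lf cf] /asboolP[lh ch]]; apply/asboolP.
  split; first by move=> k x y /=; rewrite scaler0 addr0.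
  exact: cst_continuous.
split=> [l x y|x].
  rewrite !fctE lf lh !scalerDr !scalerA mulrC -!addrA.
  by congr (_ + _); rewrite addrCA.
apply: (@cvgD _ _ _ _ _ (k \*: f) h); last exact: ch.
by apply: cvgZl_tmp; exact: cf.
Qed.

HB.instance Definition _ :=
  GRing.isSubmodClosed.Build R (B -> R^o) dual_pred dual_submod_closed.
HB.instance Definition _ := [SubChoice_isSubLmodule of dual by <:].

Definition opnorm (f : dual) : R := sup [set `|f x| | x in [set x | `|x| <= 1]].

Lemma dual_linear (f : dual) : linear f.
Proof. by case: f => f /= /asboolP[]. Qed.

Lemma dual_continuous (f : dual) : continuous f.
Proof. by case: f => f /= /asboolP[]. Qed.

HB.instance Definition _ (f : dual) :=
  GRing.isLinear.Build R B R^o *:%R f (@dual_linear f).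

Lemma opnorm_has_sup (f : dual) :
  has_sup [set `|f x| | x in [set x : B | `|x| <= 1]].
Proof.
split; first by exists `|f 0|, 0 => //=; rewrite normr0.
have /linear_bounded_continuous/linear_boundedP := @dual_continuous f.
move=> /pinfty_ex_gt0[M M0 fM]; exists M => _ [x /= x1 <-].
by rewrite (le_trans (fM x))// ler_piMr// ltW.
Qed.

Lemma opnorm_ub (f : dual) x : `|x| <= 1 -> `|f x| <= opnorm f.
Proof.
by move=> x1; apply: sup_upper_bound; [exact: opnorm_has_sup|exists x].
Qed.

Lemma opnorm_le (f : dual) M :
  (forall x : B, `|x| <= 1 -> `|f x| <= M) -> opnorm f <= M.
Proof.
move=> fM; apply: ge_sup; first by case: (opnorm_has_sup f).
by move=> _ [x /= x1 <-]; exact: fM.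
Qed.

Lemma opnormD (f h : dual) : opnorm (f + h) <= opnorm f + opnorm h.
Proof.
apply: opnorm_le => x x1; rewrite (le_trans (ler_normD _ _))//.
by rewrite lerD// opnorm_ub.
Qed.

Let opnormZ_le (k : R) (f : dual) : opnorm (k *: f) <= `|k| * opnorm f.
Proof.
apply: opnorm_le => x x1; rewrite [leLHS]normrM.
by rewrite ler_wpM2l// opnorm_ub.
Qed.

Lemma opnormZ (k : R) (f : dual) : opnorm (k *: f) = `|k| * opnorm f.
Proof.
apply/eqP; rewrite eq_le opnormZ_le/=.
have [->|k0] := eqVneq k 0.
  by rewrite normr0 mul0r (le_trans _ (opnorm_ub _ (x:=0) _)) ?normr0.
rewrite -ler_pdivlMl ?normr_gt0// -normfV.
by rewrite -[in leLHS](scalerK k0 f) opnormZ_le.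
Qed.

Lemma opnorm_eq0 (f : dual) : opnorm f = 0 -> f = 0.
Proof.
move=> f0; apply/val_inj/funext => x /=.
have [->|x0] := eqVneq x 0; first by rewrite linear0.
have /(_ (`|x|^-1 *: x)) := @opnorm_ub f.
rewrite f0 normrZ normfV normr_id mulVf ?normr_eq0// lexx => /(_ isT).
rewrite normr_le0 linearZ scaler_eq0 invr_eq0 normr_eq0 (negbTE x0)/=.
by move/eqP.
Qed.

HB.instance Definition _ :=
  Lmodule_isNormed.Build R dual opnormD opnormZ opnorm_eq0.

End dual.

(** * Bochner integral *)

Section bochner.
Local Open Scope ereal_scope.
Context {R : realType} d (T : measurableType d) (B : completeNormedModType R).
Variable mu : set T -> \bar R.

Definition bochner_simple (s : T -> B) : Prop :=
  [/\ measurable_fun [set: T] (s : T -> borel B), finite_set (range s)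
    & \int[mu]_x `|s x|%:E < +oo].

(* The value 0 does not contribute, even when mu (s @^-1` [set 0]) = +oo. *)
Definition simple_bochner_integral (s : T -> B) : B :=
  (\sum_(y \in range s) fine (mu (s @^-1` [set y])) *: y)%R.

Definition is_bochner_integral (f : T -> B) (v : B) : Prop :=
  exists s : nat -> T -> B,
    [/\ forall k, bochner_simple (s k),
        \int[mu]_x `|f x - s k x|%:E @[k --> \oo] --> 0
      & simple_bochner_integral (s k) @[k --> \oo] --> v].

(* 0 if f is not Bochner integrable *)
Definition bochner_integral (f : T -> B) : B := xget 0%R (is_bochner_integral f).

End bochner.

(** * Exponential families *)

Section exponential_family.
Local Open Scope ereal_scope.
Context {R : realType} (X : ptopologicalType) (B : completeNormedModType R).
Variables (lambda : {sigma_finite_measure set (borel X) -> \bar R}).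
Variables (beta : X -> B).

Record regular_exponential_family (Gamma : set (dual B)) : Prop := {
  ref_separable_sample : separable X ;
  ref_separable_banach : separable B ;
  ref_parameter_open : open Gamma ;
  ref_parameter_nonempty : Gamma !=set0 ;
  ref_statistic_measurable :
    measurable_fun [set: borel X] (beta : borel X -> borel B) ;
  ref_support : (convex_hull (measure_support
    (pushforward lambda (beta : borel X -> borel B))))° !=set0 ;
  ref_laplace_finite : forall gamma : dual B, Gamma gamma ->
    \int[lambda]_x (expR (gamma (beta x)))%:E < +oo
}.

Definition log_partition (gamma : dual B) : R :=
  ln (fine (\int[lambda]_x (expR (gamma (beta x)))%:E)).

Definition exp_density (gamma : dual B) (x : X) : R :=
  expR ((gamma (beta x) : R) - log_partition gamma)%R.

Definition exp_law (gamma : dual B) : set (borel X) -> \bar R :=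
  fun A => \int[lambda]_(x in A) (exp_density gamma x)%:E.

Definition mean_statistic (n : nat) (x : nat -> X) : B :=
  (n%:R^-1 *: \sum_(i < n) beta (x i))%R.

(* A probability on Theta is represented by a probability on the ambient space
   H that gives mass 1 to Theta; only the values of g on Theta matter. *)
Context (H : completeNormedModType R) (Theta : set H) (g : H -> dual B).
Variable prior : probability (borel H) R.

Definition posterior_weight (n : nat) (b : B) (theta : H) : R :=
  expR ((n%:R : R) * (g theta b - log_partition (g theta)))%R.

Definition posterior_star (n : nat) (b : B) : set (borel H) -> \bar R :=
  fun A => \int[prior]_(theta in A `&` Theta) (posterior_weight n b theta)%:E /
           \int[prior]_(theta in Theta) (posterior_weight n b theta)%:E.

Definition posterior (n : nat) (x : nat -> X) : set (borel H) -> \bar R :=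
  posterior_star n (mean_statistic n x).

End exponential_family.

(** * Wasserstein distance *)

Section wasserstein.
Local Open Scope ereal_scope.
Context {R : realType} (V : normedModType R).

(* A coupling of two measures giving full mass to Theta gives full mass to
   Theta `*` Theta: this is also the distance on probabilities on Theta. *)
Definition coupling (m1 m2 : set (borel V) -> \bar R) :
    set (probability (borel V * borel V)%type R) :=
  [set eta | forall A : set (borel V), measurable A ->
    eta (A `*` setT) = m1 A /\ eta (setT `*` A) = m2 A].

Definition wasserstein (p : R) (m1 m2 : set (borel V) -> \bar R) : \bar R :=
  ereal_inf [set (\int[eta]_z (`|(z.1 : V) - (z.2 : V)| `^ p)%:E) `^ p^-1
            | eta in coupling m1 m2].

End wasserstein.

(** * Sampling and posterior contraction *)

Section sampling.
Local Open Scope ereal_scope.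
Context {R : realType} d (Omega : measurableType d) (P : probability Omega R).

Definition mutually_independent d' (T : measurableType d')
    (xi : nat -> Omega -> T) : Prop :=
  forall (J : seq nat) (A : nat -> set T), uniq J ->
    (forall i, measurable (A i)) ->
    P (\bigcap_(i in [set` J]) (xi i @^-1` A i)) =
    \prod_(i <- J) P (xi i @^-1` A i).

Record iid_with_law d' (T : measurableType d') (xi : nat -> Omega -> T)
    (mu : set T -> \bar R) : Prop := {
  iid_measurable : forall i, measurable_fun [set: Omega] (xi i) ;
  iid_law : forall i (A : set T), measurable A -> P (xi i @^-1` A) = mu A ;
  iid_independent : mutually_independent xi
}.

(* The rate takes values in \bar R because it will be an expectation of a
   nonnegative random variable, which may be +oo; at an index with
   eps n = +oo the set below is empty. *)
Definition contraction_rate (H : normedModType R)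
    (post : nat -> Omega -> set H -> \bar R) (theta0 : H)
    (eps : nat -> \bar R) : Prop :=
  (forall n, (0 < n)%N -> 0 < eps n) /\
  forall M : nat -> R, (forall n, (0 < M n)%R) -> M n @[n --> \oo] --> +oo%R ->
  forall e : R, (0 < e)%R ->
    P [set w | e%:E < post n w
         [set theta | (M n)%:E * eps n <= `|theta - theta0|%:E]]
      @[n --> \oo] --> 0.

End sampling.

(* Main.v *)
(** The distance from the posterior to the point mass at [theta0] is the p-th root
    of its p-th moment around [theta0], because a point mass admits a single
    coupling.  On the event that [Shat n] lies in the ball, Minkowski's inequality
    on a coupling of the posteriors at [S0] and at [Shat n] reduces this moment to
    the one at [S0] plus the Lipschitz term; off the ball, the triangle inequality
    and Jensen bound it by [|theta0|] plus the moment of order [a p], to which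
    Hoelder's inequality is applied.  Markov's inequality gives the contraction.

    The posterior is a probability at every [b] and [n > 0]: the Lipschitz
    hypothesis at index [2 n] with [S' = S0] forces a coupling to exist, hence a
    finite normalizing constant at [(2 n, S0)], which domination and the Laplace
    hypothesis propagate to [(n, b)].  Measurability in [b] is lower
    semicontinuity, by Fatou's lemma. *)

Require Import Defs.
From HB Require Import structures.
From mathcomp Require Import all_boot all_order all_algebra sesquilinear.
From mathcomp Require Import all_classical all_reals all_analysis measurable_realfun.

Set Implicit Arguments.
Unset Strict Implicit.
Unset Printing Implicit Defensive.

Import Order.TTheory GRing.Theory Num.Theory.
Import numFieldNormedType.Exports.

Local Open Scope classical_set_scope.
Local Open Scope ring_scope.
Local Open Scope ereal_scope.

(** * Semicontinuity and measurability *)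

Lemma lower_semicontinuous_borel_measurable (R : realType)
    (T : ptopologicalType) (f : T -> \bar R) :
  lower_semicontinuous f -> measurable_fun [set: borel T] (f : borel T -> \bar R).
Proof.
move=> /lower_semicontinuousP fo.
apply: (measurability _ (ErealGenOInfty.measurableE R)).
move=> _ [_ [a ->]] <-; rewrite setTI preimage_itvoy.
by apply: sub_sigma_algebra; exact: fo.
Qed.

Lemma continuous_borel_measurable (S T : ptopologicalType) (f : S -> T) :
  continuous f -> measurable_fun [set: borel S] (f : borel S -> borel T).
Proof.
move=> /continuousP cf; apply: measurability; first by reflexivity.
move=> _ [A oA <-]; rewrite setTI.
by apply: sub_sigma_algebra; exact: cf.
Qed.

Lemma continuous_measurable_real (R : realType) (S : ptopologicalType)
    (f : S -> R) :
  continuous f -> measurable_fun [set: borel S] (f : borel S -> R).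
Proof.
move=> /continuousP cf; apply: (measurability _ (RGenOpens.measurableE R)).
move=> _ [_ [a [b ->]] <-]; rewrite setTI.
by apply: sub_sigma_algebra; apply: cf; exact: interval_open.
Qed.

(** Balls of radius [1/(n+1)] form a countable base of neighbourhoods. If lower semicontinuity
    failed at [v] for a level [a < f v], each ball would contain a point with value at most [a], and
    along these points the limit inferior would stay below [f v]. *)
Lemma lower_semicontinuous_seq (R : realType) (V : pseudoMetricType R)
    (f : V -> \bar R) :
  (forall (u : nat -> V) (v : V), u n @[n --> \oo] --> v ->
    f v <= limn_einf (f \o u)) ->
  lower_semicontinuous f.
Proof.
move=> fle v a afv.
apply: contrapT => nV.
have [u uP] : {u : nat -> V & forall n, ball v n.+1%:R^-1 (u n) /\ f (u n) <= a%:E}.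
  apply: (@choice _ _ (fun n x => ball v n.+1%:R^-1 x /\ f x <= a%:E)) => n.
  apply: contrapT => nx; apply: nV; exists (ball v n.+1%:R^-1).
    by apply: nbhsx_ballx; rewrite invr_gt0 ltr0n.
  move=> y vy; rewrite ltNge; apply/negP => fya; apply: nx.
  by exists y.
have uv : u n @[n --> \oo] --> v.
  apply/cvg_ballP => e e0.
  have [N _ NP] := near_infty_natSinv_lt (PosNum e0).
  exists N => // n /NP/= ne.
  by apply: le_ball (uP n).1; exact: ltW.
have := fle u v uv; apply/negP; rewrite -ltNge.
apply: le_lt_trans afv.
rewrite limn_einf_lim; apply: lime_le; first exact: is_cvg_einfs.
apply: nearW => n; apply: ereal_inf_le; exists (f (u n)) => /=.
  by exists n => //=.
exact: (uP n).2.
Qed.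

(** Fatou's lemma along a convergent sequence gives only one inequality, but it needs no integrable
    majorant, and lower semicontinuity is enough for Borel measurability. *)
Lemma integral_lower_semicontinuous (R : realType) (V : pseudoMetricType R)
    d (T : measurableType d) (m : {measure set T -> \bar R}) (D : set T)
    (k : V -> T -> R) :
  measurable D ->
  (forall v t, (0 <= k v t)%R) ->
  (forall v, measurable_fun D (k v)) ->
  (forall t, D t -> continuous (k ^~ t)) ->
  lower_semicontinuous (fun v => \int[m]_(t in D) (k v t)%:E).
Proof.
move=> mD k0 mk ck; apply: lower_semicontinuous_seq => u v uv.
have := @fatou _ _ _ m D mD (fun n t => (k (u n) t)%:E).
have h1 n : measurable_fun D (fun t => (k (u n) t)%:E).
  exact/measurable_EFinP.
have h2 n x : D x -> 0 <= (k (u n) x)%:E by rewrite lee_fin.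
move=> /(_ h1 h2); apply: le_trans.
rewrite le_eqVlt; apply/orP; left; apply/eqP.
apply: eq_integral => t; rewrite inE => Dt.
have : (k (u n) t)%:E @[n --> \oo] --> (k v t)%:E.
  apply: cvg_EFin; first by near=> n.
  exact: (cvg_comp _ _ uv (ck t Dt v)).
by move=> /cvg_limn_einf_sup[-> _].
Unshelve. all: by end_near.
Qed.

(** * Borel sets of products of separable spaces *)

Lemma separable_dense_seq (T : ptopologicalType) :
  separable T -> exists u : nat -> T, dense (range u).
Proof.
move=> [D /countable_injP[f fi] dD].
(* The injection of [D] into the naturals is inverted; indices outside its image go to [point],
   which can only enlarge the range and so keeps it dense. *)
exists (fun n => xget point [set x | D x /\ f x = n]).
move=> O O0 oO; have [x [Ox Dx]] := dD _ O0 oO.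
exists x; split => //; exists (f x) => //.
case: xgetP => [y _ [Dy fy]|/(_ x)]; last by case.
by apply: fi; rewrite ?inE.
Qed.

(** Couplings live on the product sigma-algebra, so the Borel sets of [V * V] must be shown to
    belong to it. Separability makes an open set a countable union of products of balls. *)
Lemma open_prod_borel_measurable (R : realType) (V : normedModType R)
    (U : set (V * V)) :
  separable V -> open U -> measurable (U : set (borel V * borel V)).
Proof.
move=> /separable_dense_seq[u du] oU.
pose r (k : nat) : R := (k.+1%:R^-1)%R.
pose box (i : nat * nat * nat) : set (V * V) :=
  ball (u i.1.1) (r i.2) `*` ball (u i.1.2) (r i.2).
(* Boxes that stick out of [U] become empty, so the union runs over a whole countable type. *)
pose F i := if `[< box i `<=` U >] then box i else set0.
have mb (x : V) (e : R) : measurable (ball x e : set (borel V)).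
  by apply: sub_sigma_algebra; exact: ball_open.
have mF i : measurable (F i : set (borel V * borel V)).
  rewrite /F; case: ifP => _ //.
  by apply: measurableX; exact: mb.
suff -> : U = \bigcup_i F i.
  exact: (countable_bigcupT_measurable _ mF).
apply/seteqP; split => [[x y] Uxy|xy [i _]]; last first.
  by rewrite /F; case: ifPn => // /asboolP; exact.
have /nbhs_ballP[e /= e0 eU] : nbhs (x, y) U by exact: open_nbhs_nbhs.
(* Two steps of length [r k], from [x] to the centre and from the centre to [x'], must stay within
   [e]. *)
have [k ke] : exists k, (r k < e / 2)%R.
  have e20 : (0 < e / 2)%R by rewrite divr_gt0.
  have [N _ NP] := near_infty_natSinv_lt (PosNum e20).
  by exists N; exact: (NP N (leqnn N)).
have rk0 : (0 < r k)%R by rewrite invr_gt0 ltr0n.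
have near_seq (z : V) : exists n, ball z (r k) (u n).
  have [w [zw [n _ unw]]] : ball z (r k) `&` range u !=set0.
    by apply: du; [exists z; exact: ballxx|exact: ball_open].
  by exists n; rewrite unw.
have [m xm] := near_seq x; have [n yn] := near_seq y.
exists (m, n, k) => //; rewrite /F ifT.
  by split => /=; exact: ball_sym.
apply/asboolP => -[x' y'] [/= mx ny]; apply: eU.
have tri (a b c : V) : ball a (r k) b -> ball b (r k) c -> ball a e c.
  move=> ab bc; apply: le_ball (ball_triangle ab bc).
  by rewrite [leRHS]splitr lerD// ltW.
by split => /=; [exact: tri xm mx|exact: tri yn ny].
Qed.

Lemma continuous_prod_borel_measurable (R : realType) (V : normedModType R)
    (W : ptopologicalType) (h : V * V -> W) :
  separable V -> continuous h ->
  measurable_fun [set: borel V * borel V] (h : borel V * borel V -> borel W).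
Proof.
move=> sV /continuousP ch; apply: measurability; first by reflexivity.
move=> _ [A oA <-]; rewrite setTI.
by apply: open_prod_borel_measurable => //; exact: ch.
Qed.

Lemma norm_borel_measurable (R : realType) (V : normedModType R) :
  measurable_fun [set: borel V] (fun x : borel V => `|x : V|%R : R).
Proof. by apply: continuous_measurable_real => x; exact: norm_continuous. Qed.

Lemma distr_borel_measurable (R : realType) (V : normedModType R) :
  separable V ->
  measurable_fun [set: borel V * borel V]
    (fun z : borel V * borel V => `|(z.1 : V) - (z.2 : V)|%R).
Proof.
move=> sV.
have : measurable_fun [set: borel V * borel V]
    ((fun z : V * V => (z.1 - z.2)%R) : borel V * borel V -> borel V).
  apply: continuous_prod_borel_measurable => // z.
  by apply: cvgB; [exact: cvg_fst|exact: cvg_snd].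
by move=> /(measurableT_comp (@norm_borel_measurable R V)).
Qed.

Section borel_valued_functions.
Context d (Omega : measurableType d) (R : realType) (V : normedModType R).
Hypothesis sV : separable V.

(** A pair of measurable maps is measurable for the product sigma-algebra only; separability makes
    addition measurable for it. *)
Lemma measurable_borelD (f h : Omega -> V) :
  measurable_fun [set: Omega] (f : Omega -> borel V) ->
  measurable_fun [set: Omega] (h : Omega -> borel V) ->
  measurable_fun [set: Omega] ((fun w => f w + h w)%R : Omega -> borel V).
Proof.
move=> mf mh.
have : measurable_fun [set: borel V * borel V]
    ((fun z : V * V => (z.1 + z.2)%R) : borel V * borel V -> borel V).
  apply: continuous_prod_borel_measurable => // z.
  by apply: cvgD; [exact: cvg_fst|exact: cvg_snd].
move=> mD; exact: (measurableT_comp mD (measurable_fun_pair mf mh)).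
Qed.

Lemma measurable_borel_sum n (f : nat -> Omega -> V) :
  (forall i, measurable_fun [set: Omega] (f i : Omega -> borel V)) ->
  measurable_fun [set: Omega]
    ((fun w => \sum_(i < n) f i w)%R : Omega -> borel V).
Proof.
move=> mf; elim: n => [|n IHn].
  rewrite (_ : (fun _ => _) = cst 0%R); first exact: measurable_cst.
  by apply/funext => w; rewrite big_ord0.
rewrite (_ : (fun _ => _) = fun w => (\sum_(i < n) f i w + f n w)%R).
  exact: measurable_borelD.
by apply/funext => w; rewrite big_ord_recr.
Qed.

End borel_valued_functions.

Lemma mean_statistic_measurable (R : realType) d (Omega : measurableType d)
    (X : ptopologicalType) (B : completeNormedModType R) (beta : X -> B)
    (xi : nat -> Omega -> borel X) n :
  separable B ->
  measurable_fun [set: borel X] (beta : borel X -> borel B) ->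
  (forall i, measurable_fun [set: Omega] (xi i)) ->
  measurable_fun [set: Omega]
    ((fun w => mean_statistic beta n (xi ^~ w)) : Omega -> borel B).
Proof.
move=> sB mbeta mxi.
have := @measurable_borel_sum _ Omega R B sB n (fun i w => beta (xi i w)).
have mbxi i : measurable_fun [set: Omega]
    ((fun w => beta (xi i w)) : Omega -> borel B).
  exact: measurableT_comp mbeta (mxi i).
move=> /(_ mbxi).
apply: (@measurableT_comp _ _ _ _ _ _
  ((fun y : B => n%:R^-1 *: y)%R : borel B -> borel B)).
by apply: continuous_borel_measurable => y; exact: scaler_continuous.
Qed.

(** * Densities *)

Section density.
Import HBNNSimple.
Context d (T : measurableType d) (R : realType).
Variables (mu : {measure set T -> \bar R}) (D : set T) (w : T -> R).
Hypotheses (mD : measurable D) (mw : measurable_fun D w).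
Hypothesis w0 : forall t, (0 <= w t)%R.

(** The formula holds for indicators by assumption, for simple functions by linearity, and in
    general by monotone convergence, which applies on both sides because [w] is nonnegative. *)
Lemma ge0_integral_density (nu : {measure set T -> \bar R}) (f : T -> \bar R) :
  (forall A, measurable A -> nu A = \int[mu]_(t in A `&` D) (w t)%:E) ->
  measurable_fun [set: T] f -> (forall t, 0 <= f t) ->
  \int[nu]_t f t = \int[mu]_(t in D) (f t * (w t)%:E).
Proof.
move=> nuE mf f0.
have mwE : measurable_fun D (EFin \o w) by exact/measurable_EFinP.
have simple (h : {nnsfun T >-> R}) :
    \int[nu]_t (h t)%:E = \int[mu]_(t in D) ((h t)%:E * (w t)%:E).
  transitivity (\int[mu]_(t in D) (\sum_(y \in range h)
      (y%:E * ((w t)%:E * (\1_(h @^-1` [set y]) t)%:E)))).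
    rewrite ge0_integral_fsum //; last 2 first.
    - move=> y; apply: measurable_funeM; apply: emeasurable_funM => //.
      by apply/measurable_EFinP; exact: measurable_indic.
    - move=> y t _; have [y0|y0] := leP 0%R y.
        by rewrite !mule_ge0 ?lee_fin.
      (* A negative [y] is not a value of [h], so its term vanishes. *)
      have -> : h @^-1` [set y] = set0.
        by apply/seteqP; split => // u /= hu; move: y0; rewrite -hu ltNge fun_ge0.
      by rewrite indic0 !mule0.
    rewrite integralT_nnsfun sintegralE; apply: eq_fsbigr => y _.
    have [y0|y0] := leP 0%R y; last first.
      have -> : h @^-1` [set y] = set0.
        by apply/seteqP; split => // u /= hu; move: y0; rewrite -hu ltNge fun_ge0.
      rewrite measure0 mule0 integral0_eq// => t _.
      by rewrite indic0 !mule0.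
    rewrite ge0_integralZl//; last 2 first.
    - apply: emeasurable_funM => //.
      by apply/measurable_EFinP; exact: measurable_indic.
    - by move=> t _; rewrite mule_ge0 ?lee_fin.
    congr (_ * _); rewrite nuE; last exact: measurable_sfunP.
    by rewrite integral_mkcondl epatch_indic.
  apply: eq_integral => t _.
  rewrite (fsbigD1 (h t))/=; [|by []|by exists t].
  rewrite indicE mem_set// mule1 fsbig1 ?adde0//.
  by move=> y [_ /= /nesym yh]; rewrite indicE memNset ?mule0.
pose f_ := nnsfun_approx measurableT mf.
have f_cvg t : (f_ n t)%:E @[n --> \oo] --> f t.
  exact: cvg_nnsfun_approx.
have f_nd t : {homo (fun n => (f_ n t)%:E) : m n / (m <= n)%N >-> m <= n}.
  by move=> m n mn; rewrite lee_fin; exact/lefP/nd_nnsfun_approx.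
transitivity (limn (fun n => \int[nu]_t (f_ n t)%:E)).
  rewrite -monotone_convergence//=.
  - by apply: eq_integral => t _; apply/esym/cvg_lim => //; exact: f_cvg.
  - by move=> n; exact/measurable_EFinP.
  - by move=> n t _; rewrite lee_fin.
transitivity (limn (fun n => \int[mu]_(t in D) ((f_ n t)%:E * (w t)%:E))).
  by congr (limn _); apply/funext => n; exact: simple.
rewrite -monotone_convergence//=.
- apply: eq_integral => t _; apply/cvg_lim => //.
  by apply: cvgeZr => //; exact: f_cvg.
- move=> n; apply: emeasurable_funM => //; apply/measurable_EFinP.
  exact: measurable_funTS.
- by move=> n t _; rewrite mule_ge0 ?lee_fin.
- by move=> t _ m n mn; rewrite lee_wpmul2r ?lee_fin//; exact: f_nd.
Qed.

(** The equality is one of set functions, on all sets, so that a quotient such as [posterior_star]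
    can be rewritten as a genuine measure. *)
Lemma normalized_density_probability :
  0 < \int[mu]_(t in D) (w t)%:E -> \int[mu]_(t in D) (w t)%:E < +oo ->
  exists nu : probability T R, (nu : set T -> \bar R) = fun A =>
    \int[mu]_(t in A `&` D) (w t)%:E / \int[mu]_(t in D) (w t)%:E.
Proof.
set c := (X in 0 < X) => c0 cy.
pose nu (A : set T) := \int[mu]_(t in A `&` D) (w t)%:E / c.
have cV0 : 0 <= c^-1 by rewrite inve_ge0 ltW.
(* A real inverse can be moved through the series of countable additivity. *)
have cVE : c^-1 = ((fine c)^-1)%:E.
  have /fineK cK : c \is a fin_num by rewrite ge0_fin_numE// ltW.
  by rewrite -{1}cK inver gt_eqF// -lte_fin cK.
have nu0 : nu set0 = 0 by rewrite /nu set0I integral_set0 mul0e.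
have nu_ge0 A : 0 <= nu A.
  by apply: mule_ge0 => //; apply: integral_ge0 => t _; rewrite lee_fin.
have nu_sigma : semi_sigma_additive nu.
  move=> F mF tF mUF.
  have -> : nu (\bigcup_k F k) = \sum_(k <oo) nu (F k).
    rewrite /nu cVE setI_bigcupl ge0_integral_bigcup//.
    - under [RHS]eq_eseriesr do rewrite muleC.
      rewrite nneseriesZl//; first by rewrite muleC.
      by move=> k _; apply: integral_ge0 => t _; rewrite lee_fin.
    - by move=> k; exact: measurableI.
    - apply: (measurable_funS mD); last exact/measurable_EFinP.
      by move=> t [k _ []].
    - by move=> t _; rewrite lee_fin.
    - apply/trivIsetP => i j _ _ ij; rewrite setIACA.
      by move/trivIsetP : tF => /(_ i j Logic.I Logic.I ij) ->; rewrite set0I.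
  by apply: is_cvg_nneseries => k _ _; exact: nu_ge0.
pose m0 := isMeasure.Build _ _ _ nu nu0 nu_ge0 nu_sigma.
pose m : {measure set T -> \bar R} := HB.pack nu m0.
have nuT : m setT = 1.
  by rewrite /= /nu setTI divee// ?gt_eqF// ge0_fin_numE// ltW.
pose nuP := Measure_isProbability.Build _ _ _ (m : set T -> \bar R) nuT.
pose nuPr : probability T R := HB.pack nu m0 nuP.
by exists nuPr.
Qed.

End density.

Lemma ge0_integral_normalized_density d (T : measurableType d) (R : realType)
    (mu nu : {measure set T -> \bar R}) (D : set T) (w : T -> R)
    (f : T -> \bar R) :
  measurable D -> measurable_fun D w -> (forall t, (0 <= w t)%R) ->
  0 < \int[mu]_(t in D) (w t)%:E -> \int[mu]_(t in D) (w t)%:E < +oo ->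
  (forall A, measurable A -> nu A =
    \int[mu]_(t in A `&` D) (w t)%:E / \int[mu]_(t in D) (w t)%:E) ->
  measurable_fun [set: T] f -> (forall t, 0 <= f t) ->
  \int[nu]_t f t = \int[mu]_(t in D) (f t * (w t)%:E) /
                    \int[mu]_(t in D) (w t)%:E.
Proof.
set c := (X in 0 < X) => mD mw w0 c0 cy nuE mf f0.
have cfin : c \is a fin_num by rewrite ge0_fin_numE// ltW.
have cVE : c^-1 = ((fine c)^-1)%:E.
  by rewrite -{1}(fineK cfin) inver gt_eqF// -lte_fin (fineK cfin).
have k0 : (0 <= (fine c)^-1)%R by rewrite invr_ge0 fine_ge0// ltW.
have mfD : measurable_fun D f by exact: measurable_funTS.
rewrite (@ge0_integral_density _ _ _ mu D (fun t => w t * (fine c)^-1)%R)//.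
- under eq_integral do rewrite EFinM muleA.
  rewrite ge0_integralZr// ?cVE//.
  + by apply: emeasurable_funM => //; exact/measurable_EFinP.
  + by move=> t _; rewrite mule_ge0 ?lee_fin.
- exact: measurable_funM.
- by move=> t; rewrite mulr_ge0.
- move=> A mA; rewrite nuE// cVE.
  under [RHS]eq_integral do rewrite EFinM.
  rewrite ge0_integralZr//.
  + exact: measurableI.
  + apply: (measurable_funS mD); last exact/measurable_EFinP.
    by move=> t [].
  + by move=> t _; rewrite lee_fin.
Qed.

(** * Powers of integrals *)

Lemma Lnorm_nneg d (T : measurableType d) (R : realType)
    (mu : {measure set T -> \bar R}) (f : T -> R) (p : R) :
  (forall t, (0 <= f t)%R) ->
  Lnorm mu p%:E (EFin \o f) = (\int[mu]_t (f t `^ p)%:E) `^ p^-1.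
Proof.
move=> f0; rewrite unlock; congr (_ `^ _).
by apply: eq_integral => t _ /=; rewrite ger0_norm.
Qed.

Lemma hoelder_conj_inv (R : realType) (q : R) : (1 < q)%R ->
  let q' := ((1 - q^-1)^-1)%R in
  [/\ (0 < q')%R, (q^-1 + q'^-1 = 1)%R & (q'^-1 = 1 - q^-1)%R].
Proof.
move=> q1; have q0 : (0 < q)%R by rewrite (lt_trans ltr01).
by rewrite /= invrK; split; rewrite ?invr_gt0 ?subr_gt0 ?invf_lt1// addrC subrK.
Qed.

Lemma poweR_integral_monotone d (T : measurableType d) (R : realType)
    (m : probability T R) (f : T -> R) (p a : R) :
  measurable_fun [set: T] f -> (forall t, (0 <= f t)%R) ->
  (0 < p)%R -> (1 < a)%R ->
  (\int[m]_t (f t `^ p)%:E) `^ p^-1 <=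
  (\int[m]_t (f t `^ (a * p))%:E) `^ (a * p)^-1.
Proof.
move=> mf f0 p0 a1.
have a0 : (0 < a)%R by rewrite (lt_trans ltr01).
have [a'0 aa' _] := hoelder_conj_inv a1.
have mfp : measurable_fun [set: T] (fun t => f t `^ p)%R.
  by apply: (measurableT_comp (measurable_powR p)).
(* This is Jensen's inequality obtained from Hoelder's, with second factor 1; that factor has norm 1
   because [m] has mass 1. *)
have := hoelder m mfp (measurable_cst (1%R : R)) a0 a'0 aa'.
rewrite Lnorm_nneg => [|t]; last by rewrite /= ?mulr_ge0 ?powR_ge0 ?ler01.
rewrite Lnorm_nneg => [|t]; last by rewrite /= ?mulr_ge0 ?powR_ge0 ?ler01.
rewrite Lnorm_nneg => [|t]; last by rewrite /= ?mulr_ge0 ?powR_ge0 ?ler01.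
rewrite [X in _ <= _ * X](_ : _ = 1) ?mule1; last first.
  rewrite (_ : (fun _ => _) = cst 1); last by apply/funext => t; rewrite /= powR1.
  rewrite integral_cst// mul1e.
  apply: (etrans (congr1 (poweR ^~ _) (probability_setT m))).
  exact: poweR1r.
rewrite [X in X <= _ -> _](_ : _ = \int[m]_t (f t `^ p)%:E); last first.
  rewrite invr1; apply: etrans (poweRe1 _) _; last first.
    by apply: eq_integral => t _; rewrite /= mulr1 powRr1 ?powR_ge0.
  by apply: integral_ge0 => t _; rewrite lee_fin powR_ge0.
under [in X in _ <= X -> _]eq_integral do rewrite -powRrM mulrC.
move=> /(@gt0_ler_poweR _ p^-1 _ _ _); rewrite invfM poweRrM; apply.
- by rewrite invr_ge0 ltW.
- rewrite in_itv /= leey andbT.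
  by apply: integral_ge0 => t _; rewrite lee_fin powR_ge0.
- by rewrite in_itv /= leey andbT poweR_ge0.
Qed.

(* If [J] is not integrable and [D] is null, the right-hand side is
   [+oo * 0 = 0]; the left-hand side is then an integral over a null set. *)
Lemma hoelder_poweR_restrict d (T : measurableType d) (R : realType)
    (mu : {measure set T -> \bar R}) (J : T -> \bar R) (D : set T) (q : R) :
  measurable D -> measurable_fun [set: T] J -> (forall t, 0 <= J t) ->
  (1 < q)%R ->
  \int[mu]_(t in D) (J t `^ q^-1) <=
  (\int[mu]_t J t) `^ q^-1 * mu D `^ (1 - q^-1).
Proof.
move=> mD mJ J0 q1.
have q0 : (0 < q)%R by rewrite (lt_trans ltr01).
have [q'0 qq' q'E] := hoelder_conj_inv q1.
have qV0 : (q^-1 != 0)%R by rewrite invr_neq0// gt_eqF.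
have qV1 : (0 < 1 - q^-1)%R by rewrite -q'E invr_gt0.
have mJq : measurable_fun [set: T] (fun t => J t `^ (q^-1)%R).
  exact: (measurableT_comp (measurable_poweR _)) mJ.
have [D0|D0] := eqVneq (mu D) 0.
  rewrite D0 poweR0r ?gt_eqF// mule0.
  rewrite null_set_integral//; exact: measurable_funTS.
(* Since [mu D] is now positive, an infinite integral makes the right-hand side infinite. *)
have [Jy|Jy] := eqVneq (\int[mu]_t J t) +oo.
  rewrite Jy poweRyr// gt0_mulye ?leey// poweR_gt0// lt0e D0 /=.
  exact: measure_ge0.
have Ji : mu.-integrable [set: T] J.
  apply/integrableP; split => //.
  under eq_integral do rewrite gee0_abs//.
  by rewrite lt_neqAle Jy leey.
have Jfin := integrable_ae measurableT Ji.
(* An integrable [J] is finite almost everywhere, so Hoelder's inequality for real functions applies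
   to [h] and the indicator of [D], and both sides are recovered up to a null set. *)
pose h t := (fine (J t) `^ q^-1)%R.
have mh : measurable_fun [set: T] h.
  apply: (measurableT_comp (measurable_powR (q^-1)%R)).
  exact: measurableT_comp.
have h0 t : (0 <= h t)%R by exact: powR_ge0.
have := hoelder mu mh (measurable_indic mD) q0 q'0 qq'.
rewrite Lnorm_nneg => [|t]; last by rewrite /= ?mulr_ge0.
rewrite Lnorm_nneg => [|t]; last by rewrite /= ?mulr_ge0.
rewrite Lnorm_nneg => [|t]; last by rewrite /= ?mulr_ge0.
rewrite invr1 poweRe1; last first.
  by apply: integral_ge0 => t _; rewrite lee_fin powR_ge0.
rewrite q'E.
have -> : \int[mu]_t (\1_D t `^ (1 - q^-1)^-1)%:E = mu D.
  transitivity (\int[mu]_t (\1_D t)%:E); last by rewrite integral_indic// setIT.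
  apply: eq_integral => t _.
  by rewrite indicE; case: (t \in D); rewrite ?powR1 ?powR0// gt_eqF.
have -> : \int[mu]_t (h t `^ q)%:E = \int[mu]_t J t.
  apply: ge0_ae_eq_integral => //.
  - apply/measurable_EFinP; exact: (measurableT_comp (measurable_powR q)).
  - by move=> t _; rewrite lee_fin powR_ge0.
  - apply: filterS Jfin => t /(_ Logic.I) Jt _.
    by rewrite /h -powRrM mulVf ?gt_eqF// powRr1 ?fine_ge0// fineK.
apply: le_trans; rewrite le_eqVlt; apply/orP; left; apply/eqP.
rewrite [LHS]integral_mkcond; apply: ge0_ae_eq_integral => //.
- by apply/(measurable_restrictT _ _).1 => //; exact: measurable_funTS.
- apply/measurable_EFinP; apply: (measurableT_comp (measurable_powR 1)).
  by apply: measurable_funM => //; exact: measurable_indic.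
- by move=> t _; apply: erestrict_ge0 => // u _; exact: poweR_ge0.
- by move=> t _; rewrite lee_fin powR_ge0.
apply: filterS Jfin => t /(_ Logic.I) Jt _.
rewrite epatch_indic /= powRr1 ?mulr_ge0// EFinM; congr (_ * _).
by rewrite /h -poweR_EFin fineK.
Qed.

(** * Wasserstein distance to a point mass *)

Lemma borel_set1_measurable (R : realType) (V : normedModType R) (v : V) :
  measurable ([set v] : set (borel V)).
Proof.
rewrite -[X in measurable X]setCK; apply: measurableC.
apply: sub_sigma_algebra; apply: closed_openC.
exact/accessible_closed_set1/hausdorff_accessible/norm_hausdorff.
Qed.

Section wasserstein_dirac.
Context (R : realType) (V : normedModType R).
Implicit Types (m : {measure set (borel V) -> \bar R}) (v : V) (p : R).
Hypothesis sV : separable V.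

Lemma distr_pow_measurable v p :
  measurable_fun [set: borel V] (fun x : borel V => (`|(x : V) - v| `^ p)%R).
Proof.
apply: (measurableT_comp (measurable_powR p)).
by apply: continuous_measurable_real => x; apply: cvg_norm; apply: cvgB;
  [exact: cvg_id|exact: cvg_cst].
Qed.

Lemma coupling_integral_fst m1 m2 (eta : probability (borel V * borel V)%type R)
    (f : borel V -> \bar R) :
  coupling m1 m2 eta -> measurable_fun [set: borel V] f ->
  (forall x, 0 <= f x) -> \int[eta]_z f z.1 = \int[m1]_x f x.
Proof.
move=> c mf f0.
pose X : {mfun (borel V * borel V)%type >-> borel V} :=
  HB.pack (fst : borel V * borel V -> borel V)
    (isMeasurableFun.Build _ _ _ _ _ measurable_fst).
rewrite -[LHS](@ge0_integral_distribution _ _ _ _ _ eta X)//.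
apply: eq_measure_integral => A mA _.
have [<- _] := c A mA; congr (eta _).
by apply/seteqP; split => [[x y] Ax|[x y] []].
Qed.

Lemma coupling_integral_snd m1 m2 (eta : probability (borel V * borel V)%type R)
    (f : borel V -> \bar R) :
  coupling m1 m2 eta -> measurable_fun [set: borel V] f ->
  (forall x, 0 <= f x) -> \int[eta]_z f z.2 = \int[m2]_x f x.
Proof.
move=> c mf f0.
pose X : {mfun (borel V * borel V)%type >-> borel V} :=
  HB.pack (snd : borel V * borel V -> borel V)
    (isMeasurableFun.Build _ _ _ _ _ measurable_snd).
rewrite -[LHS](@ge0_integral_distribution _ _ _ _ _ eta X)//.
apply: eq_measure_integral => A mA _.
have [_ <-] := c A mA; congr (eta _).
by apply/seteqP; split => [[x y] Ay|[x y] []].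
Qed.

Lemma wasserstein_dirac p (m : probability (borel V) R) v :
  wasserstein p m \d_(v : borel V) =
  (\int[m]_x (`|(x : V) - v| `^ p)%:E) `^ p^-1.
Proof.
have mv := borel_set1_measurable v.
have mdv : measurable_fun [set: borel V]
    (fun x : borel V => (`|(x : V) - v| `^ p)%:E).
  by apply/measurable_EFinP; exact: distr_pow_measurable.
have ndv (x : borel V) : 0 <= (`|(x : V) - v| `^ p)%:E.
  by rewrite lee_fin powR_ge0.
have cost eta : coupling m \d_(v : borel V) eta ->
    \int[eta]_z (`|(z.1 : V) - (z.2 : V)| `^ p)%:E =
    \int[m]_x (`|(x : V) - v| `^ p)%:E.
  move=> c; rewrite -(coupling_integral_fst c mdv ndv).
  apply: ge0_ae_eq_integral => //.
  - apply/measurable_EFinP; apply: (measurableT_comp (measurable_powR p)).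
    exact: distr_borel_measurable.
  - apply/measurable_EFinP.
    exact: (measurableT_comp (distr_pow_measurable v p) measurable_fst).
  (* The second marginal is the point mass at [v], so the coupling does not charge pairs whose
     second component differs from [v]; off this null set the two integrands agree. *)
  exists (setT `*` ~` [set v]); split.
  - by apply: measurableX => //; exact: measurableC.
  - have [_ e2] := c _ (measurableC mv); apply: (etrans e2).
    by rewrite diracE memNset//= => /(_ erefl).
  - move=> [x y] /= h; split => // yv; apply: h => _.
    by rewrite yv.
rewrite /wasserstein; set S := [set _ | _ in _].
suff -> : S = [set (\int[m]_x (`|(x : V) - v| `^ p)%:E) `^ p^-1].
  by rewrite ereal_inf1.
apply/seteqP; split => [_ [eta c <-]|_ ->].
  by rewrite cost.
(* The law of [(x, v)] under [m] is a coupling; without one the infimum would be taken over the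
   empty set. *)
have mpair : measurable_fun [set: borel V]
    ((fun x => (x, v)) : borel V -> (borel V * borel V)%type).
  exact: measurable_fun_pair.
pose X : {mfun borel V >-> (borel V * borel V)%type} :=
  HB.pack ((fun x => (x, v)) : borel V -> (borel V * borel V)%type)
    (isMeasurableFun.Build _ _ _ _ _ mpair).
have cX : coupling m \d_(v : borel V) (distribution m X).
  move=> A mA; rewrite /distribution /pushforward /=; split.
    by congr (m _); apply/seteqP; split => [x []|x].
  rewrite diracE; case: (boolP (v \in A)) => vA.
    rewrite -[RHS](probability_setT m); congr (m _).
    by apply/seteqP; split => // x _; split => //=; rewrite -inE.
  rewrite -[RHS](measure0 m); congr (m _).
  by apply/seteqP; split => // x [_ /=]; rewrite -(inE) (negbTE vA).
by exists (distribution m X) => //; rewrite cost.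
Qed.

(** With a point mass as third measure no gluing of couplings is needed: under any coupling of [m1]
    and [m2], Minkowski's inequality applies to [|z.1 - z.2|] and [|z.1 - v|], and the moments
    around [v] depend on the marginals only. *)
Lemma wasserstein_dirac_triangle p (m1 m2 : probability (borel V) R) v :
  (1 <= p)%R ->
  wasserstein p m2 \d_(v : borel V) <=
  wasserstein p m1 m2 + wasserstein p m1 \d_(v : borel V).
Proof.
move=> p1; rewrite !wasserstein_dirac.
set N2 := (X in X <= _); set N1 := (X in _ <= _ + X).
have N10 : 0 <= N1 by exact: poweR_ge0.
have p0 : (0 < p)%R by rewrite (lt_le_trans ltr01).
have W0 : 0 <= wasserstein p m1 m2.
  by apply: le_ereal_inf_tmp => _ [eta _ <-]; exact: poweR_ge0.
have [N1y|N1y] := eqVneq N1 +oo.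
  by rewrite N1y addey ?leey// gt_eqF// (lt_le_trans _ W0).
have N1fin : N1 \is a fin_num by rewrite ge0_fin_numE// lt_neqAle N1y leey.
(* Finiteness of [N1] allows it to be subtracted, which leaves the infimum alone on the right. *)
rewrite -leeBlDr//; apply: le_ereal_inf_tmp => _ [eta c <-].
rewrite leeBlDr//.
pose f (z : borel V * borel V) := `|(z.1 : V) - (z.2 : V)|%R.
pose h (z : borel V * borel V) := `|(z.1 : V) - v|%R.
have mdist : measurable_fun [set: borel V] (fun x : borel V => `|(x : V) - v|%R).
  by apply: continuous_measurable_real => x; apply: cvg_norm; apply: cvgB;
    [exact: cvg_id|exact: cvg_cst].
have mdv : measurable_fun [set: borel V]
    (fun x : borel V => (`|(x : V) - v| `^ p)%:E).
  by apply/measurable_EFinP; exact: distr_pow_measurable.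
have ndv (x : borel V) : 0 <= (`|(x : V) - v| `^ p)%:E.
  by rewrite lee_fin powR_ge0.
have mf : measurable_fun [set: borel V * borel V] f.
  exact: distr_borel_measurable.
have mh : measurable_fun [set: borel V * borel V] h.
  exact: (measurableT_comp mdist measurable_fst).
have f0 z : (0 <= f z)%R by exact: normr_ge0.
have h0 z : (0 <= h z)%R by exact: normr_ge0.
have := minkowski_EFin eta mf mh p1.
rewrite !Lnorm_nneg => [|z|z|z]; rewrite /= ?addr_ge0//.
have -> : \int[eta]_z (h z `^ p)%:E = \int[m1]_x (`|(x : V) - v| `^ p)%:E.
  exact: (coupling_integral_fst c mdv ndv).
apply: le_trans; rewrite /N2 -(coupling_integral_snd c mdv ndv).
apply: gt0_ler_poweR.
- by rewrite invr_ge0 ltW.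
- rewrite in_itv /= leey andbT.
  by apply: integral_ge0 => z _; rewrite lee_fin powR_ge0.
- rewrite in_itv /= leey andbT.
  by apply: integral_ge0 => z _; rewrite lee_fin powR_ge0.
apply: ge0_le_integral => //.
- apply/measurable_EFinP.
  exact: (measurableT_comp (distr_pow_measurable v p) measurable_snd).
- apply/measurable_EFinP; apply: (measurableT_comp (measurable_powR p)).
  exact: measurable_funD.
move=> z _; rewrite lee_fin.
apply: ge0_ler_powR; rewrite ?nnegrE ?addr_ge0 ?normr_ge0//; first exact: ltW.
by rewrite /f /h (distrC (z.1 : V)); exact: ler_distD.
Qed.

End wasserstein_dirac.

(** * Posterior distributions *)

Section dual_evaluation.
Context (R : realType) (B : normedModType R).

Lemma dual_le_opnorm (f : dual B) (x : B) : (`|f x| <= `|f| * `|x|)%R.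
Proof.
have [->|x0] := eqVneq x 0%R; first by rewrite linear0 !normr0 mulr0.
have nx0 : (0 < `|x|)%R by rewrite normr_gt0.
have : (`|(f : B -> R) (`|x|^-1 *: x)| <= opnorm f)%R.
  by apply: opnorm_ub; rewrite normrZ normfV normr_id mulVf ?gt_eqF.
by rewrite linearZ normrM normfV normr_id mulrC ler_pdivrMr.
Qed.

Lemma dual_eval_continuous (x : B) : continuous (fun f : dual B => f x : R).
Proof.
move=> f; apply/(@cvgrPdist_lt _ R^o _ (nbhs f)) => e e0.
(* Adding 1 covers the case [x = 0] in the radius [e / (|x| + 1)]. *)
have x10 : (0 < `|x| + 1)%R by rewrite ltr_wpDl.
apply/nbhs_ballP; exists (e / (`|x| + 1))%R => /=; first by rewrite divr_gt0.
move=> h; rewrite -ball_normE /= ltr_pdivlMr// => fh.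
have -> : ((f x : R) - h x)%R = (f - h)%R x by [].
apply: (le_lt_trans (dual_le_opnorm _ _)).
by apply: le_lt_trans fh; rewrite ler_wpM2l// lerDl.
Qed.

Lemma dual_borel_measurable (f : dual B) :
  measurable_fun [set: borel B] (f : borel B -> R).
Proof. by apply: continuous_measurable_real; exact: dual_continuous. Qed.

End dual_evaluation.

Section log_partition.
Context {R : realType} (X : ptopologicalType) (B : completeNormedModType R).
Variables (lambda : {sigma_finite_measure set (borel X) -> \bar R}).
Variables (beta : X -> B).
Hypothesis mbeta : measurable_fun [set: borel X] (beta : borel X -> borel B).

(** The Laplace integral is lower semicontinuous in [gamma] on the whole dual, including where it is
    infinite, so measurability holds without restriction to [Gamma]. *)
Lemma log_partition_measurable :
  measurable_fun [set: borel (dual B)]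
    (log_partition lambda beta : borel (dual B) -> R).
Proof.
apply: (measurableT_comp (@measurable_ln R)).
apply: measurableT_comp => //.
apply: lower_semicontinuous_borel_measurable.
apply: (@integral_lower_semicontinuous R (dual B) _ (borel X) lambda setT
  (fun gamma x => expR (gamma (beta x)))) => //.
- move=> gamma; apply: (measurableT_comp (@measurable_expR R)).
  exact: (measurableT_comp (dual_borel_measurable gamma) mbeta).
- move=> x _ gamma; apply: continuous_comp; first exact: dual_eval_continuous.
  exact: continuous_expR.
Qed.

End log_partition.

(** A zero integral would make [f] vanish almost everywhere on [D], and [D] would then lie in a null
    set. *)
Lemma integral_positive_gt0 d (T : measurableType d) (R : realType)
    (mu : {measure set T -> \bar R}) (D : set T) (f : T -> \bar R) :
  measurable D -> 0 < mu D -> measurable_fun D f ->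
  (forall t, D t -> 0 < f t) -> 0 < \int[mu]_(t in D) f t.
Proof.
move=> mD D0 mf f0; rewrite lt0e; apply/andP; split; last first.
  by apply: integral_ge0 => t Dt; rewrite ltW// f0.
apply/eqP => I0.
have : \int[mu]_(t in D) `|f t| = 0.
  by rewrite -I0; apply: eq_integral => t /[!inE] Dt; rewrite gee0_abs// ltW// f0.
move=> /(ae_eq_integral_abs mu mD mf).1[N [mN N0 DN]].
have /(le_measure mu) : D `<=` N.
  by move=> t Dt; apply: DN => /(_ Dt) ft0; move: (f0 t Dt); rewrite ft0 ltxx.
rewrite !inE => /(_ mD mN) DN0.
by have := lt_le_trans D0 DN0; rewrite [X in _ < X]N0 ltxx.
Qed.

Section posterior.
Context {R : realType} (X : ptopologicalType) (B : completeNormedModType R).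
Variables (lambda : {sigma_finite_measure set (borel X) -> \bar R}).
Variables (beta : X -> B) (H : completeNormedModType R) (Theta : set H).
Variables (g : H -> dual B) (prior : probability (borel H) R).
Hypothesis mbeta : measurable_fun [set: borel X] (beta : borel X -> borel B).
Hypothesis oTheta : open Theta.
Hypothesis prior_Theta : prior (Theta : set (borel H)) = 1.
Hypothesis mg :
  measurable_fun (Theta : set (borel H)) (g : borel H -> borel (dual B)).

Local Notation weight := (posterior_weight lambda beta g).
Local Notation star := (posterior_star lambda beta Theta g prior).
Local Notation evidence n b :=
  (\int[prior]_(theta in Theta) (weight n b theta)%:E).

Lemma parameter_set_measurable : measurable (Theta : set (borel H)).
Proof. exact: sub_sigma_algebra. Qed.

Let mTheta := parameter_set_measurable.

Lemma posterior_weight_measurable n b :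
  measurable_fun (Theta : set (borel H)) (weight n b : borel H -> R).
Proof.
rewrite /posterior_weight; apply: (measurableT_comp (@measurable_expR R)).
apply: measurable_funM => //; apply: measurable_funB.
  have := continuous_measurable_real (@dual_eval_continuous R B b).
  by move=> /measurableT_comp; apply.
have := log_partition_measurable lambda mbeta.
by move=> /measurableT_comp; apply.
Qed.

Lemma posterior_weight_continuous n theta : continuous (fun b => weight n b theta).
Proof.
move=> b; apply: continuous_comp; last exact: continuous_expR.
apply: cvgM; first exact: cvg_cst.
apply: cvgB; last exact: cvg_cst.
exact: dual_continuous.
Qed.

Lemma posterior_weight_ge0 n b theta : (0 <= weight n b theta)%R.
Proof. exact: expR_ge0. Qed.

Lemma evidence_gt0 n b : 0 < evidence n b.
Proof.
apply: integral_positive_gt0 => //.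
- apply: (lt_le_trans lte01); rewrite le_eqVlt; apply/orP; left.
  exact/eqP/esym.
- by apply/measurable_EFinP; exact: posterior_weight_measurable.
- by move=> theta _; rewrite lte_fin expR_gt0.
Qed.

(** The inverse of [+oo] is 0, so an infinite evidence would turn [star n b] into the zero set
    function, which is not the marginal of a probability. *)
Lemma coupling_evidence_finite n b m2 :
  coupling (star n b) m2 !=set0 -> evidence n b < +oo.
Proof.
move=> [eta c]; rewrite ltNge leye_eq; apply/negP => /eqP ey.
have [e1 _] := c setT measurableT.
have : (1 : \bar R) = 0.
  rewrite -(probability_setT eta) -setXTT; apply: (etrans e1).
  by rewrite /posterior_star setTI ey invey mule0.
by move/eqP; rewrite onee_eq0.
Qed.

(** Without couplings the infimum is [+oo]; a finite distance therefore provides one. *)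
Lemma wasserstein_evidence_finite p n b m2 :
  wasserstein p (star n b) m2 < +oo -> evidence n b < +oo.
Proof.
move=> Wy; apply: (@coupling_evidence_finite n b m2).
apply/set0P; apply/negP => /eqP c0.
by move: Wy; rewrite /wasserstein c0 image_set0 ereal_inf0 ltxx.
Qed.

(* Since [n (g b - M)] is the mean of [2 n (g S - M)] and [2 n g (b - S)], its
   exponential is at most the sum of theirs. *)
Lemma evidence_finite n S b :
  evidence n.*2 S < +oo ->
  \int[prior]_(theta in Theta) (expR ((n.*2%:R : R) * g theta (b - S)%R))%:E < +oo ->
  evidence n b < +oo.
Proof.
move=> eS eb.
have mexp : measurable_fun (Theta : set (borel H))
    (fun theta : borel H => expR ((n.*2%:R : R) * g theta (b - S)%R)).
  apply: (measurableT_comp (@measurable_expR R)); apply: measurable_funM => //.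
  have := continuous_measurable_real (@dual_eval_continuous R B (b - S)%R).
  by move=> /measurableT_comp; apply.
apply: (@le_lt_trans _ _ (\int[prior]_(theta in Theta)
    ((weight n.*2 S theta)%:E +
     (expR ((n.*2%:R : R) * g theta (b - S)%R))%:E))).
  apply: ge0_le_integral => //.
  - by move=> theta _; rewrite lee_fin expR_ge0.
  - by apply/measurable_EFinP; exact: posterior_weight_measurable.
  - apply: emeasurable_funD; last exact/measurable_EFinP.
    by apply/measurable_EFinP; exact: posterior_weight_measurable.
  move=> theta _; rewrite -EFinD lee_fin.
  set M := log_partition lambda beta (g theta).
  pose u := ((n.*2%:R : R) * (g theta S - M))%R.
  pose v := ((n.*2%:R : R) * g theta (b - S)%R)%R.
  have uv : ((n%:R : R) * (g theta b - M) = (u + v) / 2)%R.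
    rewrite /u /v linearB /= -muln2 natrM -mulrDr.
    rewrite -!mulrA; congr (_ * _)%R.
    by rewrite mulrCA mulfV ?pnatr_eq0// mulr1 [RHS]addrC [RHS]addrA subrK.
  rewrite /posterior_weight -/M uv -/u -/v.
  (* The mean of [u] and [v] is at most the larger of the two, and the other exponential is
     nonnegative. *)
  have [le_uv|/ltW le_vu] := leP u v.
    apply: (@le_trans _ _ (expR v)); last by rewrite lerDr expR_ge0.
    by rewrite ler_expR ler_pdivrMr// mulr_natr mulr2n lerD2r.
  apply: (@le_trans _ _ (expR u)); last by rewrite lerDl expR_ge0.
  by rewrite ler_expR ler_pdivrMr// mulr_natr mulr2n lerD2l.
rewrite ge0_integralD//; first exact: lte_add_pinfty.
- by move=> theta _; rewrite lee_fin expR_ge0.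
- by apply/measurable_EFinP; exact: posterior_weight_measurable.
- exact/measurable_EFinP.
Qed.

Section finite_evidence.
Variable n : nat.
Hypothesis ey : forall b, evidence n b < +oo.

Lemma posterior_star_probability b :
  exists nu : probability (borel H) R, (nu : set (borel H) -> \bar R) = star n b.
Proof.
apply: normalized_density_probability => //.
- exact: posterior_weight_measurable.
- exact: posterior_weight_ge0.
- exact: evidence_gt0.
Qed.

Lemma integral_posterior_star b (f : borel H -> \bar R) :
  measurable_fun [set: borel H] f -> (forall t, 0 <= f t) ->
  \int[star n b]_theta f theta =
  \int[prior]_(theta in Theta) (f theta * (weight n b theta)%:E) / evidence n b.
Proof.
move=> mf f0; have [nu nuE] := posterior_star_probability b.
rewrite -nuE; apply: ge0_integral_normalized_density => //.
- exact: posterior_weight_measurable.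
- exact: posterior_weight_ge0.
- exact: evidence_gt0.
- by move=> A _; exact: (congr1 (@^~ A) nuE).
Qed.

Lemma integral_posterior_star_restrict b (f : borel H -> \bar R) :
  measurable_fun [set: borel H] f -> (forall t, 0 <= f t) ->
  \int[star n b]_(theta in Theta) f theta = \int[star n b]_theta f theta.
Proof.
move=> mf f0; have [nu nuE] := posterior_star_probability b.
transitivity (\int[star n b]_theta (f \_ Theta) theta).
  by rewrite -nuE integral_mkcond.
rewrite !integral_posterior_star//.
- congr (_ / _); apply: eq_integral => t tTheta.
  by rewrite patchE tTheta.
- by apply/(measurable_restrictT _ _).1 => //; exact: measurable_funTS.
- by move=> t; apply: erestrict_ge0.
Qed.

(** Numerator and evidence are each lower semicontinuous in [b]; their quotient need not be, but it
    is measurable. *)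
Lemma integral_posterior_star_measurable (F : borel H -> R) :
  measurable_fun [set: borel H] F -> (forall t, (0 <= F t)%R) ->
  measurable_fun [set: borel B]
    ((fun b => \int[star n b]_theta (F theta)%:E) : borel B -> \bar R).
Proof.
move=> mF F0.
have lsc (G : borel H -> R) : measurable_fun [set: borel H] G ->
    (forall t, (0 <= G t)%R) -> measurable_fun [set: borel B]
    ((fun b => \int[prior]_(theta in Theta)
       (G theta * weight n b theta)%:E) : borel B -> \bar R).
  move=> mG G0; apply: lower_semicontinuous_borel_measurable.
  apply: (@integral_lower_semicontinuous R B _ (borel H) prior Theta
    (fun b theta => (G theta * weight n b theta)%R)) => //.
  - by move=> b t; rewrite mulr_ge0// posterior_weight_ge0.
  - move=> b; apply: measurable_funM; first exact: measurable_funTS.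
    exact: posterior_weight_measurable.
  - move=> theta _ b; apply: cvgM; first exact: cvg_cst.
    exact: posterior_weight_continuous.
(* The inverse becomes the power -1, a measurable operation; the two agree because the evidence is
   positive and finite. *)
rewrite (_ : (fun _ => _) = fun b : borel B =>
    \int[prior]_(theta in Theta) (F theta * weight n b theta)%:E *
    (\int[prior]_(theta in Theta) (1 * weight n b theta)%:E) `^ (-1)).
  apply: emeasurable_funM; first exact: lsc.
  apply: (measurableT_comp (measurable_poweR _)); apply: lsc => //.
apply/funext => b; rewrite integral_posterior_star//; last exact/measurable_EFinP.
congr (_ * _).
under [in RHS]eq_integral do rewrite mul1r.
have efin : evidence n b \is a fin_num.
  by rewrite ge0_fin_numE// ltW// evidence_gt0.
have e0 : (0 < fine (evidence n b))%R by rewrite -lte_fin fineK// evidence_gt0.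
by rewrite -(fineK efin) inver gt_eqF// poweR_EFin powR_inv1// ltW.
Qed.

Lemma posterior_star_measurable (A : set (borel H)) :
  measurable A ->
  measurable_fun [set: borel B] ((fun b => star n b A) : borel B -> \bar R).
Proof.
move=> mA.
rewrite (_ : (fun _ => _) =
    (fun b : borel B => \int[star n b]_theta (\1_A theta)%:E)).
  exact: integral_posterior_star_measurable.
apply/funext => b; have [nu <-] := posterior_star_probability b.
by rewrite integral_indic// setIT.
Qed.

End finite_evidence.

End posterior.

(** * Inequalities for moments and masses *)

Lemma markov_ge0 d (T : measurableType d) (R : realType)
    (mu : {measure set T -> \bar R}) (f : T -> \bar R) (a : R) :
  measurable_fun [set: T] f -> (forall t, 0 <= f t) -> (0 < a)%R ->
  a%:E * mu [set t | a%:E <= f t] <= \int[mu]_t f t.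
Proof.
move=> mf f0 a0.
have := @le_integral_comp_abse _ _ _ mu setT measurableT f a id
  (@measurable_id _ _ _) (fun r r0 => r0) (fun x y _ _ xy => xy) mf a0.
rewrite setTI; under eq_integral do rewrite gee0_abs//.
by under [in X in mu X]eq_set do rewrite gee0_abs//.
Qed.

(** Minkowski's inequality with one function equal to the constant [|v|], whose norm is [|v|] under
    a probability. *)
Lemma poweR_integral_translate (R : realType) (V : normedModType R)
    (m : probability (borel V) R) (p : R) (v : V) : (1 <= p)%R ->
  (\int[m]_x (`|(x : V) - v| `^ p)%:E) `^ p^-1 <=
  `|v|%:E + (\int[m]_x (`|x : V| `^ p)%:E) `^ p^-1.
Proof.
move=> p1; have p0 : (0 < p)%R by rewrite (lt_le_trans ltr01).
have mn := @norm_borel_measurable R V.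
have := minkowski_EFin m (measurable_cst (`|v|%R : R)) mn p1.
rewrite Lnorm_nneg => [|t]; last by rewrite /= ?addr_ge0 ?normr_ge0.
rewrite Lnorm_nneg => [|t]; last by rewrite /= ?addr_ge0 ?normr_ge0.
rewrite Lnorm_nneg => [|t]; last by rewrite /= ?addr_ge0 ?normr_ge0.
rewrite [X in _ <= X + _ -> _](_ : _ = `|v|%:E); last first.
  rewrite (_ : (fun _ => _) = cst (`|v| `^ p)%:E)//.
  rewrite integral_cst//.
  apply: (etrans (congr1 (fun r => ((`|v| `^ p)%:E * r) `^ p^-1) (probability_setT m))).
  by rewrite mule1 poweR_EFin -powRrM mulfV ?gt_eqF// powRr1.
apply: le_trans; apply: gt0_ler_poweR.
- by rewrite invr_ge0 ltW.
- rewrite in_itv /= leey andbT.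
  by apply: integral_ge0 => x _; rewrite lee_fin powR_ge0.
- rewrite in_itv /= leey andbT.
  by apply: integral_ge0 => x _; rewrite lee_fin powR_ge0.
apply: ge0_le_integral => //.
- by apply/measurable_EFinP; exact: distr_pow_measurable.
- apply/measurable_EFinP; apply: (measurableT_comp (measurable_powR p)).
  exact: measurable_funD.
move=> x _; rewrite lee_fin.
apply: ge0_ler_powR; rewrite ?nnegrE /= ?addr_ge0 ?normr_ge0//; first exact: ltW.
by rewrite [leRHS]addrC; exact: ler_normB.
Qed.

(** This serves the positivity of the rate: a prior other than the point mass at [theta0] charges
    the points where the distance to [theta0] is positive. *)
Lemma probability_setD1_gt0 (R : realType) (V : normedModType R)
    (m : probability (borel V) R) (D : set V) (v : V) :
  measurable (D : set (borel V)) -> m (D : set (borel V)) = 1 ->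
  m [set v] < 1 -> 0 < m ((D `\ v) : set (borel V)).
Proof.
move=> mD D1 v1; have mv := borel_set1_measurable v.
rewrite lt0e measure_ge0 andbT; apply/eqP => D0.
have mDv : measurable ((D `\ v) : set (borel V)) by exact: measurableD.
have vD : m (D `\ v) + m [set v] < 1 by rewrite [X in X + _]D0 add0e.
have := le_lt_trans (measureU2 m mDv mv) vD.
apply/negP; rewrite -leNgt -[X in X <= _]D1.
apply: le_measure; rewrite ?inE//; first exact: measurableU.
by move=> x Dx; have [->|xv] := eqVneq x v; [right|left; split => //; apply/eqP].
Qed.

(** * Contraction rates *)

(** Markov's inequality is used twice: under the posterior at fixed [w], to pass from the mass of
    the far set to the root moment, and then under [P], where the mean of the root moment is
    [eps n]. *)
Lemma contraction_rate_moment (R : realType) (V : normedModType R)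
    d (Omega : measurableType d) (P : probability Omega R)
    (post : nat -> Omega -> set (borel V) -> \bar R) (v : V) (p : R)
    (eps : nat -> \bar R) :
  let rootmoment n w := (\int[post n w]_x (`|(x : V) - v| `^ p)%:E) `^ p^-1 in
  (0 < p)%R ->
  (forall n w, (0 < n)%N -> exists nu : probability (borel V) R,
    (nu : set (borel V) -> \bar R) = post n w) ->
  (forall n (A : set (borel V)), (0 < n)%N -> measurable A ->
    measurable_fun [set: Omega] (fun w => post n w A)) ->
  (forall n, (0 < n)%N -> measurable_fun [set: Omega] (rootmoment n)) ->
  (forall n, (0 < n)%N -> eps n = \int[P]_w rootmoment n w) ->
  (forall n, (0 < n)%N -> 0 < eps n) ->
  contraction_rate P post v eps.
Proof.
move=> rootmoment p0 postP mpost mroot epsE eps0; split => // M M0 My e e0.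
have p0V : (0 <= p^-1)%R by rewrite invr_ge0 ltW.
pose far n : set (borel V) := [set x : V | (M n)%:E * eps n <= `|x - v|%:E].
have mdist : measurable_fun [set: borel V] (fun x : borel V => `|(x : V) - v|%:E).
  apply/measurable_EFinP; apply: continuous_measurable_real => x.
  by apply: cvg_norm; apply: cvgB; [exact: cvg_id|exact: cvg_cst].
have mfar n : measurable (far n).
  by have := measurable_lee measurableT (measurable_cst ((M n)%:E * eps n))
    mdist; rewrite setTI.
have er0 : (0 < e `^ p^-1)%R by exact: powR_gt0.
have bound n : (0 < n)%N ->
    P [set w | e%:E < post n w (far n)] <= ((e `^ p^-1 * M n)^-1)%:E.
  move=> n0.
  have RHS0 : (0 <= (e `^ p^-1 * M n)^-1)%R.
    by rewrite invr_ge0 mulr_ge0 ?ltW.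
  (* With an infinite rate no point is far, and the event in question is empty. *)
  have [epsy|epsy] := eqVneq (eps n) +oo.
    have far0 : far n = set0.
      apply/seteqP; split => // x; rewrite /far /= epsy gt0_muley ?lte_fin//.
    rewrite (_ : [set _ | _] = set0) ?measure0 ?lee_fin//.
    apply/seteqP; split => // w /=; rewrite far0.
    have [nu <-] := postP n w n0.
    by rewrite measure0 lte_fin ltNge (ltW e0).
  have epsfin : eps n \is a fin_num.
    by rewrite ge0_fin_numE ?ltW ?eps0// lt_neqAle epsy leey.
  have feps0 : (0 < fine (eps n))%R by rewrite -lte_fin fineK// eps0.
  pose c := (M n * fine (eps n))%R.
  have c0 : (0 < c)%R by rewrite mulr_gt0.
  (* The far set is rewritten with p-th powers, so that Markov's inequality applies to the p-th
     moment. *)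
  have farE : far n = [set x | (c `^ p)%:E <= (`|(x : V) - v| `^ p)%:E].
    apply/seteqP; split => x; rewrite /far /= -(fineK epsfin) -EFinM !lee_fin.
      by move=> cx; rewrite ge0_ler_powR ?nnegrE ?(ltW c0) ?(ltW p0).
    rewrite leNgt => cx; rewrite leNgt; apply: contra cx => cx.
    by rewrite gt0_ltr_powR ?nnegrE ?(ltW c0).
  have sub : [set w | e%:E < post n w (far n)] `<=`
      [set w | (e `^ p^-1 * c)%:E <= rootmoment n w].
    move=> w /= ew; have [nu nuE] := postP n w n0.
    have cint : (c `^ p)%:E * post n w (far n) <=
        \int[post n w]_x (`|(x : V) - v| `^ p)%:E.
      rewrite -nuE farE; apply: markov_ge0 => //.
      - by apply/measurable_EFinP; exact: distr_pow_measurable.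
      - exact: powR_gt0.
    have ce : ((e * c `^ p)%:E <= \int[post n w]_x (`|(x : V) - v| `^ p)%:E).
      apply: le_trans cint; rewrite mulrC EFinM lee_pmul2l//.
      - exact: ltW.
      - by rewrite lte_fin powR_gt0.
    have -> : ((e `^ p^-1 * c)%:E = (e * c `^ p)%:E `^ p^-1).
      rewrite poweR_EFin powRM ?powR_ge0 ?(ltW e0)// -powRrM mulfV ?gt_eqF//.
      by rewrite powRr1 ?(ltW c0).
    apply: gt0_ler_poweR => //.
    - by rewrite in_itv /= leey lee_fin mulr_ge0 ?powR_ge0 ?(ltW e0).
    - rewrite in_itv /= leey andbT -nuE.
      by apply: integral_ge0 => x _; rewrite lee_fin powR_ge0.
  have mset1 : measurable [set w | e%:E < post n w (far n)].
    have := measurable_lte measurableT (measurable_cst e%:E)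
      (mpost n (far n) n0 (mfar n)).
    by rewrite setTI.
  have mset2 : measurable [set w | (e `^ p^-1 * c)%:E <= rootmoment n w].
    have := measurable_lee measurableT (measurable_cst (e `^ p^-1 * c)%:E)
      (mroot n n0).
    by rewrite setTI.
  have := markov_ge0 P (mroot n n0) (fun w => poweR_ge0 _ _) (mulr_gt0 er0 c0).
  rewrite -epsE// -(fineK epsfin) => mk.
  apply: (le_trans (le_measure P _ _ sub)); rewrite ?inE//.
  (* After multiplication by the threshold, the factor [eps n] hidden in [c] cancels against the
     mean, and only the p-th root of [e] and [M n] remain. *)
  rewrite -(@lee_pmul2l _ (e `^ p^-1 * c)%:E)//; last first.
    by rewrite lte_fin mulr_gt0.
  apply: (le_trans mk); rewrite -EFinM lee_fin /c mulrA.
  by rewrite mulrAC mulfV ?mul1r// gt_eqF// mulr_gt0.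
have cvg0 : ((e `^ p^-1 * M n)^-1)%:E @[n --> \oo] --> 0.
  apply: cvg_EFin; first by near=> n.
  rewrite (_ : _ \o _ = fun n => ((e `^ p^-1 * M n)^-1)%R)//.
  apply/gtr0_cvgV0; first by near=> n; rewrite mulr_gt0.
  apply/cvgryPge => A; move/cvgryPge : My => /(_ (A / (e `^ p^-1))%R).
  by apply: filterS => n; rewrite ler_pdivrMr// mulrC.
apply: (@squeeze_cvge _ _ _ _ (cst 0) _ _ _ _ _ cvg0); last exact: cvg_cst.
near=> n; rewrite measure_ge0 /= bound//.
(* The bound requires [n > 0], which holds eventually. *)
by near: n; exists 1%N.
Unshelve. all: by end_near.
Qed.

(** * The Wasserstein contraction rate and its bound *)

Theorem theorem3p2 (R : realType) (p : R)
  (X : ptopologicalType) (B : completeNormedModType R)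
  (lambda : {sigma_finite_measure set (borel X) -> \bar R})
  (beta : X -> B) (Gamma : set (dual B))
  (H : completeNormedModType R) (Theta : set H)
  (prior : probability (borel H) R) (g : H -> dual B) (theta0 : H)
  (d : measure_display) (Omega : measurableType d) (P : probability Omega R)
  (xi : nat -> Omega -> borel X)
  (S0 : B) (a : R) (delta L0 : nat -> R) (eps : nat -> \bar R) :
  (1 <= p)%R ->
  regular_exponential_family lambda beta Gamma ->
  hilbert H -> separable H ->
  open Theta -> connected Theta ->
  prior (Theta : set (borel H)) = 1 ->
  measurable_fun (Theta : set (borel H)) (g : borel H -> borel (dual B)) ->
  (forall theta, Theta theta -> Gamma (g theta)) ->
  Theta theta0 ->
  iid_with_law P xi (exp_law lambda beta (g theta0)) ->
  S0 = bochner_integral (exp_law lambda beta (g theta0)) beta ->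
  \int[lambda]_x (`|beta x| * exp_density lambda beta (g theta0) x)%:E < +oo ->
  (forall (n : nat) (b : B),
    \int[prior]_(tau in Theta) (expR ((n%:R : R) * g tau b))%:E < +oo) ->
  (1 < a)%R ->
  \int[prior]_(theta in Theta) (`|theta : H| `^ (a * p))%:E < +oo ->
  (forall n, (0 < n)%N -> (0 < delta n)%R) ->
  (forall n, (0 < n)%N -> (0 < L0 n)%R) ->
  (forall n, (0 < n)%N -> forall S' : B, ball S0 (delta n) S' ->
    wasserstein p (posterior_star lambda beta Theta g prior n S0)
                  (posterior_star lambda beta Theta g prior n S')
      <= (L0 n * `|S0 - S'|)%:E) ->
  (forall n, eps n = \int[P]_w
    wasserstein p (posterior lambda beta Theta g prior n (xi ^~ w)) \d_(theta0 : borel H)) ->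
  let Shat n w := mean_statistic beta n (xi ^~ w) in
  let outside n := P [set w | ~ ball S0 (delta n) (Shat n w)] in
  (* the point mass at theta0 gives eps n = 0, which is not a positive rate *)
  (prior [set theta0] < 1 ->
    contraction_rate P
      (fun n w => posterior lambda beta Theta g prior n (xi ^~ w)) theta0 eps) /\
  exists2 C : R, (0 < C)%R & forall n, (0 < n)%N ->
    eps n <= C%:E *
     ((\int[posterior_star lambda beta Theta g prior n S0]_(theta in Theta)
         (`|(theta : H) - theta0| `^ p)%:E) `^ p^-1
      + `|theta0|%:E * outside n
      + (\int[P]_w
           \int[posterior_star lambda beta Theta g prior n (Shat n w)]_(theta in Theta)
             (`|theta : H| `^ (a * p))%:E) `^ (a * p)^-1
        * outside n `^ (1 - (a * p)^-1)
      + (L0 n)%:E * \int[P]_w `|Shat n w - S0|%:E).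
Proof.
move=> p1 reg _ sH oTheta _ pT mg _ _ [mxi _ _] _ _ ii a1 _ delta0 L00 iv epsE.
move=> Shat outside.
have p0 : (0 < p)%R by rewrite (lt_le_trans ltr01).
have p0V : (0 <= p^-1)%R by rewrite invr_ge0 ltW.
have a0 : (0 < a)%R by rewrite (lt_trans ltr01).
have ap1 : (1 < a * p)%R by rewrite (lt_le_trans a1)// ler_pMr.
have [_ sB _ _ mbeta _ _] := reg.
have mTheta := parameter_set_measurable oTheta.
have mw n b :=
  @posterior_weight_measurable R X B lambda beta H Theta g mbeta mg n b.
have ey n b : (0 < n)%N -> \int[prior]_(theta in Theta)
    (posterior_weight lambda beta g n b theta)%:E < +oo.
  move=> n0; apply: (evidence_finite mbeta oTheta mg (S := S0)) => //.
  have n20 : (0 < n.*2)%N by rewrite double_gt0.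
  have dS : ball S0 (delta n.*2) S0.
    by apply: ballxx; exact: delta0.
  (* Only the finiteness of the Lipschitz bound matters here. *)
  apply: (wasserstein_evidence_finite (p := p)
    (m2 := posterior_star lambda beta Theta g prior n.*2 S0)).
  by apply: le_lt_trans (iv _ n20 _ dS) _; rewrite ltry.
have starP n b : (0 < n)%N -> exists nu : probability (borel H) R,
    (nu : set (borel H) -> \bar R) = posterior_star lambda beta Theta g prior n b.
  move=> n0; apply: posterior_star_probability => // b'; exact: ey.
have mShat n : measurable_fun [set: Omega] (Shat n : Omega -> borel B).
  exact: mean_statistic_measurable.
have mdist v q : measurable_fun [set: borel H]
    (fun x : borel H => (`|(x : H) - v| `^ q)%R).
  exact: distr_pow_measurable.
pose root n b := (\int[posterior_star lambda beta Theta g prior n b]_theta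
  (`|(theta : H) - theta0| `^ p)%:E) `^ p^-1.
have mroot n : (0 < n)%N ->
    measurable_fun [set: borel B] (root n : borel B -> \bar R).
  move=> n0; apply: (measurableT_comp (measurable_poweR _)).
  apply: integral_posterior_star_measurable => //.
  by move=> b; exact: ey.
have mrootS n : (0 < n)%N ->
    measurable_fun [set: Omega] (fun w => root n (Shat n w)).
  by move=> n0; exact: (measurableT_comp (mroot n n0) (mShat n)).
have WE n b : (0 < n)%N -> wasserstein p
    (posterior_star lambda beta Theta g prior n b) \d_(theta0 : borel H) = root n b.
  move=> n0; rewrite /root; have [nu <-] := starP n b n0.
  exact: wasserstein_dirac.
have epsrE n : (0 < n)%N -> eps n = \int[P]_w root n (Shat n w).
  by move=> n0; rewrite epsE; apply: eq_integral => w _; exact: WE.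
split.
  move=> pi1; apply: (contraction_rate_moment (p := p)) => //.
  - by move=> n w n0; exact: starP.
  - move=> n A n0 mA.
    have mstar : measurable_fun [set: borel B]
        ((fun b => posterior_star lambda beta Theta g prior n b A) : borel B -> \bar R).
      by apply: posterior_star_measurable => // b; exact: ey.
    exact: (measurableT_comp mstar (mShat n)).
  move=> n n0; rewrite epsrE//; apply: integral_positive_gt0 => //.
  - apply: (lt_le_trans lte01); rewrite le_eqVlt; apply/orP; left.
    by apply/eqP/esym; exact: probability_setT.
  - exact: mrootS.
  move=> w _; apply: poweR_gt0.
  rewrite integral_posterior_star//; last 2 first.
  - by move=> b; exact: ey.
  - exact/measurable_EFinP.
  set b := Shat n w.
  have e0 := evidence_gt0 lambda mbeta oTheta pT mg n b.
  (* The inverse of the evidence is positive because the evidence is finite. *)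
  apply: mule_gt0; last by rewrite inve_gt0 ?(gt_eqF e0) ?(lt_eqF (ey n b n0)).
  have mfw : measurable_fun (Theta : set (borel H)) (fun theta : borel H =>
      (`|(theta : H) - theta0| `^ p)%:E *
      (posterior_weight lambda beta g n b theta)%:E).
    apply: emeasurable_funM; apply/measurable_EFinP => //.
    exact: measurable_funTS.
  have mD : measurable ((Theta `\ theta0) : set (borel H)).
    by apply: measurableD => //; exact: borel_set1_measurable.
  (* The integrand is positive away from [theta0], and the prior charges the rest of [Theta]. *)
  apply: (@lt_le_trans _ _ (\int[prior]_(theta in Theta `\ theta0)
    ((`|(theta : H) - theta0| `^ p)%:E *
     (posterior_weight lambda beta g n b theta)%:E))).
    apply: integral_positive_gt0 => //.
    - exact: probability_setD1_gt0.
    - by apply: measurable_funS mfw => // x [].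
    - move=> x [_ /= /eqP x0]; apply: mule_gt0; rewrite lte_fin ?expR_gt0//.
      by rewrite powR_gt0// normr_gt0 subr_eq0.
  apply: ge0_subset_integral => //.
  by move=> x _; apply: mule_ge0; rewrite lee_fin ?powR_ge0 ?expR_ge0.
(* No step below loses a factor, so the multiplicative constant is 1. *)
exists 1%R => // n n0; rewrite mul1e epsrE//.
set q := (a * p)%R in ap1 *.
pose out : set Omega := [set w | ~ ball S0 (delta n) (Shat n w)].
have mout : measurable out.
  have mb : measurable (ball S0 (delta n) : set (borel B)).
    by apply: sub_sigma_algebra; exact: ball_open.
  have := measurableC (mShat n measurableT _ mb).
  by rewrite setTI.
pose J w := \int[posterior_star lambda beta Theta g prior n (Shat n w)]_(theta in Theta)
  (`|theta : H| `^ q)%:E.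
have mnormq : measurable_fun [set: borel H] (fun x : borel H => (`|x : H| `^ q)%R).
  by apply: (measurableT_comp (measurable_powR q)); exact: norm_borel_measurable.
have nnormq (x : borel H) : 0 <= (`|x : H| `^ q)%:E by rewrite lee_fin powR_ge0.
have JE w : J w = \int[posterior_star lambda beta Theta g prior n (Shat n w)]_theta
    (`|theta : H| `^ q)%:E.
  apply: integral_posterior_star_restrict => //; last exact/measurable_EFinP.
  by move=> b; exact: ey.
have J0 w : 0 <= J w.
  by rewrite JE; have [nu <-] := starP n (Shat n w) n0; apply: integral_ge0.
have mJ : measurable_fun [set: Omega] J.
  rewrite (_ : J = (fun b => \int[posterior_star lambda beta Theta g prior n b]_theta
    (`|theta : H| `^ q)%:E) \o Shat n); last exact/funext.
  apply: measurableT_comp (mShat n).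
  by apply: integral_posterior_star_measurable => // b; exact: ey.
have A0E : (\int[posterior_star lambda beta Theta g prior n S0]_(theta in Theta)
    (`|(theta : H) - theta0| `^ p)%:E) `^ p^-1 = root n S0.
  congr (_ `^ _); apply: integral_posterior_star_restrict => //.
    by move=> b; exact: ey.
  exact/measurable_EFinP.
rewrite A0E.
(* [T2], [T3] and [T4] are the random terms whose means give, or are bounded by, the last three
   summands; [T2] and [T3] vanish when the statistic lies in the ball. *)
pose T2 := (cst `|theta0|%:E : Omega -> \bar R) \_ out.
pose T3 := (fun w => J w `^ (q^-1)%R) \_ out.
pose T4 w := (L0 n * `|Shat n w - S0|)%:E.
have T20 w : 0 <= T2 w by apply: erestrict_ge0 => w' _ /=; rewrite lee_fin.
have T30 w : 0 <= T3 w by apply: erestrict_ge0 => w' _ /=; exact: poweR_ge0.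
have T40 w : 0 <= T4 w by rewrite lee_fin mulr_ge0// ltW// L00.
have A00 : 0 <= root n S0 by exact: poweR_ge0.
have mT2 : measurable_fun [set: Omega] T2.
  by apply/(measurable_restrictT _ _).1.
have mT3 : measurable_fun [set: Omega] T3.
  apply/(measurable_restrictT _ _).1 => //; apply: measurable_funTS.
  exact: (measurableT_comp (measurable_poweR _) mJ).
have mdS : measurable_fun [set: Omega] (fun w => `|Shat n w - S0|%R).
  have mB : measurable_fun [set: borel B] (fun x : borel B => `|(x : B) - S0|%R).
    apply: continuous_measurable_real => x.
    by apply: cvg_norm; apply: cvgB; [exact: cvg_id|exact: cvg_cst].
  exact: (measurableT_comp mB (mShat n)).
have mT4 : measurable_fun [set: Omega] T4.
  by apply/measurable_EFinP; exact: measurable_funM.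
have tri b b' : root n b' <= wasserstein p
    (posterior_star lambda beta Theta g prior n b)
    (posterior_star lambda beta Theta g prior n b') + root n b.
  rewrite -(WE n b n0) -(WE n b' n0).
  case: (starP n b n0) => nu <-; case: (starP n b' n0) => nu' <-.
  exact: wasserstein_dirac_triangle.
(* Inside the ball the triangle inequality through the posterior at [S0] gives the first and last
   terms; outside, the translation and power inequalities give the middle two, and the others are
   nonnegative. *)
have pointwise w : root n (Shat n w) <= root n S0 + T2 w + T3 w + T4 w.
  have [inb|outb] := pselect (ball S0 (delta n) (Shat n w)).
    have wN : w \notin out by rewrite notin_setE /out /=; exact.
    rewrite /T2 /T3 !patchE (negbTE wN) !adde0.
    apply: (le_trans (tri S0 (Shat n w))).
    by rewrite addeC leeD2l// /T4 distrC; exact: iv.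
  have wI : w \in out by rewrite inE.
  rewrite /T2 /T3 !patchE wI.
  apply: (@le_trans _ _ (`|theta0|%:E + J w `^ (q^-1)%R)); last first.
    by apply: (le_trans _ (leeDl _ (T40 w))); rewrite -addeA; exact: leeDr.
  have [nu nuE] := starP n (Shat n w) n0.
  rewrite /root JE -nuE.
  apply: (le_trans (poweR_integral_translate nu theta0 p1)).
  rewrite leeD2l//; apply: poweR_integral_monotone => //.
  exact: norm_borel_measurable.
have mA0 : measurable_fun [set: Omega] (cst (root n S0)).
  exact: measurable_cst.
have m12 := emeasurable_funD mA0 mT2.
have m123 := emeasurable_funD m12 mT3.
have A12 w : 0 <= root n S0 + T2 w by exact: adde_ge0.
have A123 w : 0 <= root n S0 + T2 w + T3 w by exact: adde_ge0.
apply: (@le_trans _ _ (\int[P]_w (root n S0 + T2 w + T3 w + T4 w))).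
  apply: ge0_le_integral.
  - exact: measurableT.
  - by move=> w _; exact: poweR_ge0.
  - exact: mrootS.
  - exact: (emeasurable_funD m123 mT4).
  - by move=> w _; exact: pointwise.
rewrite (ge0_integralD P measurableT (fun w _ => A123 w) m123
  (fun w _ => T40 w) mT4).
rewrite (ge0_integralD P measurableT (fun w _ => A12 w) m12
  (fun w _ => T30 w) mT3).
rewrite (ge0_integralD P measurableT (fun w _ => A00) mA0
  (fun w _ => T20 w) mT2).
apply: leeD; last first.
  under eq_integral do rewrite /T4 EFinM.
  rewrite ge0_integralZl//.
  - exact/measurable_EFinP.
  - by rewrite lee_fin ltW// L00.
(* Hoelder's inequality on [out] with exponent [q] bounds the mean of [T3]. *)
apply: leeD; last first.
  rewrite /T3 -integral_mkcond.
  exact: hoelder_poweR_restrict.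
apply: leeD.
  rewrite integral_cst//.
  by rewrite [X in _ * X](probability_setT P) mule1.
by rewrite /T2 -integral_mkcond integral_cst.
Qed.
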